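(* Let $k\geqslant 1$ be an integer and let $G$ be any graph with $|V(G)|\geqslant k$. Then $$\gamma_{k\text{-SRD}}(G)\leqslant (k+1)\,\gamma(G),$$ where $\gamma(G)$ is the domination number of $G$.
   Context: All graphs are finite, simple and undirected; $N(v)$ denotes the set of neighbors of $v$ and $\Delta(G)$ the maximum degree. Let $k\geqslant 1$ be an integer with $|V(G)|\geqslant k$. An attack pattern is a set $P\subseteq V(G)$ with $|P|=k$. A function $f:V(G)\to\{0,1,\ldots,\min(\Delta(G),k)+1\}$ is a proper $k$-SRD ($k$-strong Roman domination) function if for each attack pattern $P$ every vertex $u\in P$ with $f(u)=0$ can be defended by a neighboring vertex, where each vertex $v$ with $f(v)\geqslant 2$ can defend at most $f(v)-1$ of its neighbors in $P$ labeled 0 (and vertices with label $\leqslant 1$ defend no other vertex). That is, for each $P$ there is a map $\delta_P:\{u\in P : f(u)=0\}\to V(G)$ (which may depend on $P$) such that $\delta_P(u)\in N(u)$ and $f(\delta_P(u))\geqslant 2$ for all $u$ in its domain, and $|\delta_P^{-1}(v)|\leqslant f(v)-1$ for every $v$ with $f(v)\geqslant 2$. The weight is $\omega(f)=\sum_{v\in V(G)}f(v)$, and the $k$-SRD number is $\gamma_{k\text{-SRD}}(G)=\min\{\omega(f) : f \text{ is a proper } k\text{-SRD function on } G\}$. The domination number $\gamma(G)$ is the minimum cardinality of a set $D\subseteq V(G)$ such that every vertex of $V(G)\setminus D$ has at least one neighbor in $D$. *)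

(* Defs.v *)
From mathcomp Require Import all_boot.

Set Implicit Arguments.
Unset Strict Implicit.
Unset Printing Implicit Defensive.

Record sgraph := SGraph {
  vertex :> finType;
  adj : rel vertex;
  adj_sym : symmetric adj;
  adj_irrefl : irreflexive adj
}.

Section Graph.
Variable G : sgraph.

Definition neighbors (v : G) : {set G} := [set u | adj v u].

Definition max_degree : nat := \max_(v : G) #|neighbors v|.

Definition dominating (D : {set G}) : bool :=
  [forall v in ~: D, exists u in D, u \in neighbors v].

Lemma dominating_setT : dominating setT.
Proof. by apply/forall_inP => v; rewrite setCT inE. Qed.

(* The seed [setT] only witnesses that dominating sets exist; see
   [domination_numberP]. *)
Definition domination_number : nat :=
  #|[arg min_(D < setT | dominating D) #|D| ]|.

Lemma domination_numberP :
  (exists2 D, dominating D & #|D| = domination_number) /\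
  (forall D, dominating D -> domination_number <= #|D|).
Proof.
rewrite /domination_number; case: arg_minnP => [|D domD minD].
  exact: dominating_setT.
by split=> [|D' /minD //]; exists D.
Qed.

Variable k : nat.

Definition attack_pattern (P : {set G}) : bool := #|P| == k.

Definition labeling := {ffun G -> 'I_(minn max_degree k).+2}.

Implicit Types (f : labeling) (P : {set G}) (delta : {ffun G -> G}).

Definition attacked_zeros f P : {set G} := [set u in P | f u == 0 :> nat].

(* The defense map of the pattern P is only meaningful on [attacked_zeros f P];
   the values of the total function [delta] elsewhere are never inspected. *)
Definition defends f P delta : bool :=
  [forall u in attacked_zeros f P,
     (delta u \in neighbors u) && (2 <= f (delta u))] &&
  [forall v, (2 <= f v) ==>
     (#|[set u in attacked_zeros f P | delta u == v]| <= f v - 1)].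

Definition proper_srd f : bool :=
  [forall P, attack_pattern P ==> [exists delta, defends f P delta]].

Definition weight f : nat := \sum_(v : G) f v.

Definition all_ones : labeling := [ffun=> inord 1].

Lemma proper_all_ones : proper_srd all_ones.
Proof.
apply/forall_inP => P _; apply/existsP; exists [ffun v => v].
have z0 : attacked_zeros all_ones P = set0.
  by apply/setP => u; rewrite !inE ffunE inordK ?andbF.
rewrite /defends z0; apply/andP; split; first by apply/forall_inP => u; rewrite inE.
apply/forall_inP => v _; rewrite (_ : [set _ in _ | _] = set0) ?cards0 //.
by apply/setP => u; rewrite !inE.
Qed.

(* The seed [all_ones] only witnesses that proper functions exist; see
   [srd_numberP]. *)
Definition srd_number : nat :=
  weight [arg min_(f < all_ones | proper_srd f) weight f].

Lemma srd_numberP :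
  (exists2 f, proper_srd f & weight f = srd_number) /\
  (forall f, proper_srd f -> srd_number <= weight f).
Proof.
rewrite /srd_number; case: arg_minnP => [|f propf minf].
  exact: proper_all_ones.
by split=> [|f' /minf //]; exists f.
Qed.

End Graph.

(* Main.v *)
(** Give every vertex of a minimum dominating set the largest admissible label
    [min(Delta, k) + 1] and every other vertex [0].  An attacked zero is defended
    by a dominator; a dominator is responsible for at most [Delta] neighbors and
    at most [k] attacked vertices, so its label suffices. *)
Require Import Defs.
From mathcomp Require Import all_boot.

Set Implicit Arguments.
Unset Strict Implicit.
Unset Printing Implicit Defensive.

Section DominatingLabeling.
Variables (k : nat) (G : sgraph).
Implicit Types (D P : {set G}) (u v w : G).

Definition dominating_labeling D : labeling G k :=
  [ffun v => if v \in D then ord_max else ord0].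

Lemma dominating_labelingE D v :
  dominating_labeling D v = (v \in D) * (minn (max_degree G) k).+1 :> nat.
Proof. by rewrite ffunE; case: (v \in D); rewrite /= ?mul1n. Qed.

Lemma weight_dominating_labeling D :
  weight (dominating_labeling D) = #|D| * (minn (max_degree G) k).+1.
Proof.
rewrite -sum1_card big_distrl [RHS]big_mkcond /weight /=; apply: eq_bigr => v _.
by rewrite dominating_labelingE; case: (v \in D).
Qed.

Lemma degree_le_max v : #|neighbors v| <= max_degree G.
Proof. exact: (leq_bigmax (F := fun v : G => #|neighbors v|)). Qed.

Lemma proper_dominating_labeling D :
  0 < k -> dominating D -> proper_srd (dominating_labeling D).
Proof.
move=> k_gt0 /forall_inP domD; apply/forall_inP => P /eqP cardP; apply/existsP.
(* One map, independent of [P], serves all patterns. The default [u] is never reached on attacked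
   zeros, as each has a neighbor in [D]. *)
pose delta := [ffun u => odflt u [pick w in D | w \in neighbors u]].
have deltaP u : u \in attacked_zeros (dominating_labeling D) P ->
    (delta u \in D) && (delta u \in neighbors u).
  (* The second factor is a successor, so label 0 forces [u] outside [D]. *)
  rewrite inE dominating_labelingE muln_eq0 orbF eqb0 => /andP[_ uND].
  have /exists_inP[w wD uw] : [exists w in D, w \in neighbors u].
    by apply: domD; rewrite inE.
  by rewrite ffunE; case: pickP => [//|/(_ w)]; rewrite wD uw.
exists delta; apply/andP; split.
  apply/forall_inP => u /deltaP/andP[dD du].
  (* Label at least 2 requires [max_degree G] and [k] to be positive; the edge from [u] to [delta u]
     gives the former. *)
  rewrite du dominating_labelingE dD mul1n ltnS leq_min k_gt0 andbT /=.
  by apply: leq_trans (degree_le_max u); apply/card_gt0P; exists (delta u).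
apply/forall_inP => v; rewrite dominating_labelingE.
(* Outside [D] the label is 0, so nothing is asked of [v]. *)
case: (v \in D) => // _; rewrite mul1n subn1 leq_min; apply/andP; split.
  apply: leq_trans (degree_le_max v); apply/subset_leq_card/subsetP => u.
  by rewrite inE => /andP[/deltaP/andP[_ +] /eqP <-]; rewrite !inE adj_sym.
rewrite -[leqRHS]cardP; apply/subset_leq_card/subsetP => u.
by rewrite !inE => /andP[/andP[]].
Qed.

End DominatingLabeling.

Theorem proposition5 (k : nat) (G : sgraph) (k_ge1 : 1 <= k)
    (k_le_order : k <= #|{: G}|) :
  srd_number G k <= (k + 1) * domination_number G.
Proof.
have [[D domD <-] _] := domination_numberP G.
have [_ min_srd] := srd_numberP G k.
apply: leq_trans (min_srd _ (proper_dominating_labeling k_ge1 domD)) _.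
(* The minimum in the label is relaxed to [k]. *)
by rewrite weight_dominating_labeling mulnC addn1 leq_mul2r ltnS geq_minr orbT.
Qed.
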